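(* For every finite simple graph $G$ with maximum degree at most $3$ (a subcubic graph), $\overrightarrow{\beta}(G,1)\le 2$.
   Context: Firefighting on oriented graphs: an orientation $\overrightarrow{G}$ of a finite simple graph $G$ replaces each edge $uv$ by exactly one of the arcs $\overrightarrow{uv}$, $\overrightarrow{vu}$. Let $f\ge 1$ be an integer. A fire breaks out at a vertex $v$ at time $1$ ($v$ burns). At the end of each time unit, the firefighters permanently protect up to $f$ vertices that are neither burning nor already protected. At the next time unit, every vertex that is neither burning nor protected and is an out-neighbour of a burning vertex starts to burn. The process ends when no new vertex can burn. $\beta(\overrightarrow{G},f)$ is the maximum, over all starting vertices $v$, of the minimum, over all protection strategies, of the number of vertices that burn. $\overrightarrow{\beta}(G,f)$ is the minimum of $\beta(\overrightarrow{G},f)$ over all orientations $\overrightarrow{G}$ of $G$. *)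

(* Defs.v *)
From mathcomp Require Import all_boot.
From mathcomp Require Import boolp.

Set Implicit Arguments.
Unset Strict Implicit.
Unset Printing Implicit Defensive.

Local Open Scope nat_scope.

Record sgraph := SGraph {
  svertex :> finType;
  sedge : rel svertex;
  sedge_sym : symmetric sedge;
  sedge_irrefl : irreflexive sedge
}.

Definition degree (G : sgraph) (v : G) : nat := #|[set u | sedge v u]|.

Definition max_degree (G : sgraph) : nat := \max_(v : G) degree v.

Record orientation (G : sgraph) := Orientation {
  arc :> rel G;
  arc_sedge : forall u v, arc u v -> sedge u v;
  sedge_arc : forall u v, sedge u v -> arc u v (+) arc v u
}.

Section Firefighting.
Variables (G : sgraph) (o : orientation G) (f : nat).

(* Time units are numbered from 1 while indices start at 0: [S t] is the set
   of vertices newly protected at the end of time unit [t.+1]. As the fire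
   spreads deterministically, a strategy need not depend on the history. *)
Definition strategy := nat -> {set G}.

(* The vertices already protected when time unit [t.+1] starts. *)
Definition protected (S : strategy) (t : nat) : {set G} := \bigcup_(i < t) S i.

(* The vertices burning at time [t.+1] when the fire breaks out at [v]. *)
Fixpoint burning (v : G) (S : strategy) (t : nat) : {set G} :=
  if t is t'.+1 then
    burning v S t' :|:
    [set x | (x \notin protected S t) && [exists u in burning v S t', o u x]]
  else [set v].

Definition valid_strategy (v : G) (S : strategy) : Prop :=
  forall t, #|S t| <= f /\ [disjoint S t & burning v S t :|: protected S t].

Definition burnt (v : G) (S : strategy) : {set G} :=
  [set x | `[< exists t, x \in burning v S t >]].

Lemma burnt_number_exists (v : G) :
  exists k, `[< exists S, valid_strategy v S /\ #|burnt v S| = k >].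
Proof.
exists #|burnt v (fun=> set0)|; apply/asboolP; exists (fun=> set0); split=> // t.
by rewrite cards0; split=> //; rewrite disjoints_subset sub0set.
Qed.

Definition min_burnt (v : G) : nat := ex_minn (burnt_number_exists v).

Definition beta : nat := \max_(v : G) min_burnt v.

End Firefighting.

Lemma orientation_exists (G : sgraph) : inhabited (orientation G).
Proof.
have H1 (u v : G) : sedge u v && (enum_rank u < enum_rank v) -> sedge u v.
  by case/andP.
have H2 (u v : G) : sedge u v ->
    (sedge u v && (enum_rank u < enum_rank v)) (+)
    (sedge v u && (enum_rank v < enum_rank u)).
  move=> uv; rewrite [sedge v u]sedge_sym uv /=.
  case: ltngtP => // /ord_inj/enum_rank_inj uv_eq.
  by rewrite uv_eq sedge_irrefl in uv.
by constructor; exact: (Orientation H1 H2).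
Qed.

Lemma beta_value_exists (G : sgraph) (f : nat) :
  exists k, `[< exists o : orientation G, beta o f = k >].
Proof.
by case: (orientation_exists G) => o; exists (beta o f); apply/asboolP; exists o.
Qed.

Definition obeta (G : sgraph) (f : nat) : nat := ex_minn (beta_value_exists G f).

(* Main.v *)
Require Import Defs.
From mathcomp Require Import all_boot.
From mathcomp Require Import boolp zify.

Set Implicit Arguments.
Unset Strict Implicit.
Unset Printing Implicit Defensive.

(** List the vertices as a concatenation of greedy paths: always continue with
    an unlisted neighbour of the last vertex if there is one. A vertex with a
    later neighbour is then adjacent to its immediate successor. Orient an edge
    backwards if its ends are consecutive in the list, and forwards otherwise.
    Every vertex has at most one backward out-neighbour, and a vertex with a
    forward out-neighbour also has its successor as an in-neighbour. So if [w]
    is a forward out-neighbour of [v], then [v] has out-degree at most 2, and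
    [w] has out-degree at most 1: otherwise [w] would have two out-neighbours
    and the two in-neighbours [v] and the successor of [w]. The firefighter lets
    the fire spread from [v] to [w] only, and stops it there. *)

Section GreedyListing.
Variables (T : finType) (e : rel T).

(** The default of [head] never matters: on an empty tail the premise [has (e x) s'] is false. *)
Fixpoint greedy (s : seq T) : bool :=
  if s is x :: s' then (has (e x) s' ==> e x (head x s')) && greedy s'
  else true.

Lemma greedy_nth (x0 : T) (s : seq T) (i j : nat) :
  greedy s -> i < j < size s -> e (nth x0 s i) (nth x0 s j) ->
  e (nth x0 s i) (nth x0 s i.+1).
Proof.
elim: s i j => [|x s IHs] [|i] [|j] //=; rewrite ?ltnS ?andbF // => /andP[gx gs].
  move=> js exj; have /(implyP gx) : has (e x) s.
    by apply/hasP; exists (nth x0 s j) => //; apply: mem_nth.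
  by case: {gx gs exj IHs} s js.
exact: IHs.
Qed.

(** The head is prescribed so that the induction can start the listing of [A :\ r] at a neighbour of
    [r] whenever one remains. *)
Lemma greedy_listing_from (A : {set T}) (r : T) : r \in A ->
  exists s, [/\ uniq (r :: s), r :: s =i A & greedy (r :: s)].
Proof.
move: {2}#|A| (leqnn #|A|) => n; elim: n A r => [|n IHn] A r.
  by rewrite leqn0 cards_eq0 => /eqP ->; rewrite inE.
move=> leA rA; have le' : #|A :\ r| <= n by move: leA; rewrite (cardsD1 r A) rA.
have step c : c \in A :\ r -> (has (e r) (enum (A :\ r)) -> e r c) ->
    exists s, [/\ uniq (r :: s), r :: s =i A & greedy (r :: s)].
  move=> cA ec; have [s [us sE gs]] := IHn _ _ le' cA.
  exists (c :: s); split.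
  - by rewrite cons_uniq us sE !inE eqxx.
  - by move=> x; rewrite in_cons sE !inE; case: eqVneq => // ->; rewrite rA.
  - rewrite /= -/(greedy (c :: s)) gs andbT; apply/implyP => rs.
    have /hasP[x xs rx] : has (e r) (c :: s) := rs.
    by apply: ec; apply/hasP; exists x => //; rewrite mem_enum -sE.
have [/hasP[c]|no] := boolP (has (e r) (enum (A :\ r))).
  by rewrite mem_enum => cA rc; apply: (step c).
(* The current path is stuck at [r]; any remaining vertex may start the next path. *)
have [A0|[c cA]] := set_0Vmem (A :\ r); last first.
  by apply: (step c) => // h; rewrite h in no.
exists [::]; split=> // x; rewrite inE.
by have := in_set0 x; rewrite -A0 !inE; case: eqVneq => [->|].
Qed.

Lemma greedy_numbering : exists h : T -> nat,
  injective h /\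
  forall u v, e u v -> h u < h v -> exists2 w, e u w & h w = (h u).+1.
Proof.
have [r _|T0] := pickP (@predT T); last first.
  by exists (fun=> 0); split=> [x|x]; have := T0 x.
have [s [us sE gs]] := greedy_listing_from (in_setT r).
have sT x : x \in r :: s by rewrite sE inE.
exists (index^~ (r :: s)); split=> [x y xy|].
  by rewrite -(nth_index r (sT x)) xy nth_index.
move=> u v euv ltuv; have ltv : index v (r :: s) < size (r :: s).
  by rewrite index_mem.
exists (nth r (r :: s) (index u (r :: s)).+1).
  rewrite -{1}(nth_index r (sT u)).
  by apply: (greedy_nth gs (j := index v (r :: s))); rewrite ?ltuv // !nth_index.
by rewrite index_uniq // (leq_ltn_trans ltuv).
Qed.

End GreedyListing.

Definition numbering_arc (G : sgraph) (h : G -> nat) : rel G :=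
  fun u v => sedge u v && (((h u).+1 < h v) || (h u == (h v).+1)).

Lemma numbering_arc_sedge (G : sgraph) (h : G -> nat) (u v : G) :
  numbering_arc h u v -> sedge u v.
Proof. by case/andP. Qed.

Lemma sedge_numbering_arc (G : sgraph) (h : G -> nat) (u v : G) :
  injective h -> sedge u v -> numbering_arc h u v (+) numbering_arc h v u.
Proof.
move=> h_inj uv; rewrite /numbering_arc (sedge_sym v u) uv /=.
have : h u <> h v by move=> /h_inj uvE; rewrite uvE sedge_irrefl in uv.
lia.
Qed.

Definition numbering_orientation (G : sgraph) (h : G -> nat)
    (h_inj : injective h) : orientation G :=
  Orientation (@numbering_arc_sedge G h)
    (fun u v => @sedge_numbering_arc G h u v h_inj).

Definition out_nbrs (G : sgraph) (o : orientation G) (v : G) : {set G} :=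
  [set u | o v u].

Lemma arc_irrefl (G : sgraph) (o : orientation G) : irreflexive o.
Proof.
by move=> v; apply/negP => /arc_sedge; rewrite sedge_irrefl.
Qed.

Lemma arc_asym (G : sgraph) (o : orientation G) (u v : G) :
  o u v -> o v u = false.
Proof.
by move=> uv; have := sedge_arc o (arc_sedge uv); rewrite uv /=; case: (o v u).
Qed.

Lemma min_burnt_le (G : sgraph) (o : orientation G) (f : nat) (v : G)
    (S : strategy G) :
  valid_strategy o f v S -> min_burnt o f v <= #|burnt o v S|.
Proof.
move=> vS; rewrite /min_burnt; case: ex_minnP => k _; apply.
by apply/asboolP; exists S.
Qed.

(* With [w = v] this covers the case where the fire is stopped at once. *)
Lemma min_burnt_le2 (G : sgraph) (o : orientation G) (f : nat) (v w : G) :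
  #|out_nbrs o v :\ w| <= f -> #|out_nbrs o w| <= f -> min_burnt o f v <= 2.
Proof.
move=> fv fw.
(* Validity forbids protecting what already burns or is protected. Nothing is lost: the
   out-neighbours of [v] other than [w] are protected by [S 0]. *)
pose S1 := out_nbrs o w :\: (v |: (w |: out_nbrs o v)).
pose S (t : nat) : {set G} :=
  match t with 0 => out_nbrs o v :\ w | 1 => S1 | _ => set0 end.
have S0P t : S 0 \subset protected S t.+1.
  by rewrite /protected big_ord_recl subsetUl.
have S1P t : S 1 \subset protected S t.+2.
  by rewrite /protected 2!big_ord_recl subsetU // subsetUl orbT.
have out_v t x : x \notin protected S t.+1 -> o v x -> x = w.
  move=> xP vx; apply/eqP; apply: contraNT xP => xw.
  by apply: (subsetP (S0P t)); rewrite !inE xw.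
have burn t : burning o v S t \subset [set v; w].
  elim: t => [|t IHt]; first by rewrite sub1set !inE eqxx.
  rewrite subUset IHt /=; apply/subsetP => x.
  rewrite inE => /andP[xP /existsP[u /andP[ub ux]]].
  have [uv|nuv] := eqVneq u v.
    by rewrite !inE (out_v _ _ xP) ?eqxx ?orbT // -uv.
  (* At index 0 only [v] burns, so fire can leave [w] at index 2 at the earliest, when [S 1] is
     already in place. *)
  case: t IHt xP ub => [|t] IHt xP ub; first by rewrite inE (negbTE nuv) in ub.
  move: (subsetP IHt _ ub); rewrite !inE (negbTE nuv) /= => /eqP uw.
  have [|vx] := boolP (o v x); first by move/(out_v _ _ xP) => ->; rewrite eqxx orbT.
  apply: contraNT xP => xvw; apply: (subsetP (S1P t)).
  by rewrite !inE orbA negb_or xvw vx -uw.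
have vS : valid_strategy o f v S.
  case=> [|[|t]].
  - split=> //; rewrite disjoints_subset; apply/subsetP => x.
    rewrite !inE /protected big_ord0 inE orbF => /andP[_].
    by apply: contraTneq => ->; rewrite arc_irrefl.
  - split; first exact: leq_trans (subset_leq_card (subsetDl _ _)) fw.
    rewrite disjoints_subset; apply/subsetP => x.
    rewrite in_setD in_setC => /andP[xN _]; apply: contra xN.
    rewrite inE => /orP[/(subsetP (burn 1))|]; first by rewrite !inE orbA => ->.
    by rewrite /protected big_ord1 !inE => /andP[_ ->]; rewrite !orbT.
  - by rewrite cards0 disjoints_subset sub0set.
apply: leq_trans (min_burnt_le vS) _.
have : #|[set v; w]| <= 2 by rewrite cards2; case: (v != w).
apply: leq_trans; apply: subset_leq_card; apply/subsetP => x.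
by rewrite inE => /asboolP[t]; apply: (subsetP (burn t)).
Qed.

Section NumberingBound.
Variables (G : sgraph) (h : G -> nat) (h_inj : injective h).
Hypothesis h_next : forall u v : G,
  sedge u v -> h u < h v -> exists2 w, sedge u w & h w = (h u).+1.

Let o := numbering_orientation h_inj.

Lemma forward_arc_succ_in (v w : G) :
  o v w -> h v < h w -> exists2 c, o c v & h c = (h v).+1.
Proof.
move=> vw lt_vw; have [c vc hc] := h_next (arc_sedge vw) lt_vw.
by exists c => //; rewrite /= /numbering_arc sedge_sym vc hc eqxx orbT.
Qed.

(** An arc that does not go forwards ends at the immediate predecessor, which is unique by
    injectivity of [h]. *)
Lemma card_out_le1 (v : G) :
  (forall w, o v w -> h w <= h v) -> #|out_nbrs o v| <= 1.
Proof.
move=> back; apply/card_le1_eqP => x y; rewrite !inE => vx vy.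
have := back _ vx; have := back _ vy.
case/andP: vx => _ hx; case/andP: vy => _ hy ? ?.
by apply: h_inj; lia.
Qed.

(** No edge is oriented both ways, so the two sets are disjoint parts of the neighbourhood of
    [v]. *)
Lemma card_out_in_le_degree (v : G) (I : {set G}) :
  {in I, forall u, o u v} -> #|out_nbrs o v| + #|I| <= degree v.
Proof.
move=> Iv; have dis : out_nbrs o v :&: I = set0.
  apply/setP => x; rewrite !inE; apply/andP => -[vx /Iv].
  by rewrite (arc_asym vx).
rewrite -cardsUI dis cards0 addn0; apply/subset_leq_card/subsetP => x.
by rewrite !inE => /orP[|/Iv] /arc_sedge //; rewrite sedge_sym.
Qed.

Lemma numbering_min_burnt (v : G) :
  (forall u : G, degree u <= 3) -> min_burnt o 1 v <= 2.
Proof.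
move=> deg3; have [/existsP[w /andP[vw lt_vw]]|] :=
    boolP [exists w, o v w && (h v < h w)]; last first.
  rewrite negb_exists => /forallP back.
  have out_v : #|out_nbrs o v| <= 1.
    apply: card_out_le1 => w vw; have := back w.
    by rewrite vw /= -leqNgt.
  apply: (min_burnt_le2 (w := v)) => //.
  exact: leq_trans (subset_leq_card (subsetDl _ _)) out_v.
apply: (min_burnt_le2 (w := w)).
  (* The in-neighbour [c] leaves at most two arcs out of [v]. One goes to [w], so at most one vertex
     needs protection. *)
  have [c cv _] := forward_arc_succ_in vw lt_vw.
  have := @card_out_in_le_degree v [set c].
  rewrite cards1 (cardsD1 w (out_nbrs o v)) [w \in _]inE vw => le_deg.
  have : forall u, u \in [set c] -> o u v by move=> u /set1P ->.
  by move/le_deg; have := deg3 v; lia.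
have [/existsP[x /andP[wx lt_wx]]|] :=
    boolP [exists x, o w x && (h w < h x)]; last first.
  rewrite negb_exists => /forallP back; apply: card_out_le1 => x wx.
  by have := back x; rewrite wx /= -leqNgt.
have [c cw hc] := forward_arc_succ_in wx lt_wx.
(* [c] comes after [w] and [v] before it, so these in-neighbours of [w] are distinct and leave at
   most one arc out of [w]. *)
have cards_cv : #|[set c; v]| = 2.
  by rewrite cards2; case: eqVneq => // cv; rewrite -cv hc in lt_vw; lia.
have : forall u, u \in [set c; v] -> o u w by move=> u /set2P[] ->.
by move/card_out_in_le_degree; rewrite cards_cv; have := deg3 w; lia.
Qed.

End NumberingBound.

Lemma obeta_le_beta (G : sgraph) (f : nat) (o : orientation G) :
  obeta G f <= beta o f.
Proof.
rewrite /obeta; case: ex_minnP => k _; apply.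
by apply/asboolP; exists o.
Qed.

Theorem theorem5p5 (G : sgraph) (hG : max_degree G <= 3) : obeta G 1 <= 2.
Proof.
have [h [h_inj h_next]] := greedy_numbering (@sedge G).
apply: leq_trans (obeta_le_beta 1 (numbering_orientation h_inj)) _.
apply/bigmax_leqP => v _; apply: numbering_min_burnt => // u.
exact: leq_trans (leq_bigmax u) hG.
Qed.
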